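(* Let $W$ be the compact scattered ordinal space $[0,\omega_2]$ with the order topology and let $X=W_\delta$ be its $G_\delta$-modification. Then $X$ is a Lindel\''of $P$-space in which each ordinal with countable cofinality (including $0$ and successor ordinals) is isolated and each ordinal with uncountable cofinality is a limit point, and $X$ is not a $\Delta$-space.
   Context: The $G_\delta$-modification $W_\delta$ of a topological space $W$ is the space on the same underlying set whose topology is generated by the family of all $G_\delta$-sets of $W$. A $P$-space is a topological space in which countable intersections of open sets are open. A topological space $X$ is a $\Delta$-space if for every decreasing sequence $\{D_n:n\in\omega\}$ of subsets of $X$ with empty intersection there is a decreasing sequence $\{V_n:n\in\omega\}$ of open subsets of $X$, also with empty intersection, such that $D_n\subseteq V_n$ for every $n\in\omega$. *)

(* Defs.v *)
From HB Require Import structures.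
From mathcomp Require Import all_boot all_order interval.
From mathcomp Require Import wochoice.
From mathcomp Require Import all_classical topology sequences borel_hierarchy.

Set Implicit Arguments.
Unset Strict Implicit.
Unset Printing Implicit Defensive.

Import Order.TTheory.

Local Open Scope classical_set_scope.
Local Open Scope card_scope.

Definition Gdelta_modification (T : Type) : Type := T.

HB.instance Definition _ (T : topologicalType) :=
  Choice.on (Gdelta_modification T).
HB.instance Definition _ (T : topologicalType) :=
  @isSubBaseTopological.Build (Gdelta_modification T)
    (set T) (@Gdelta T) id.

Definition P_space (T : topologicalType) : Prop :=
  forall F : (set T)^nat, (forall i, open (F i)) -> open (\bigcap_i F i).

Definition lindelof (T : topologicalType) : Prop :=
  forall U : set (set T),
    (forall A, U A -> open A) -> \bigcup_(A in U) A = [set: T] ->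
    exists V : set (set T),
      [/\ V `<=` U, countable V & \bigcup_(A in V) A = [set: T]].

Definition scattered (T : topologicalType) : Prop :=
  forall A : set T, A !=set0 -> isolated A !=set0.

Definition Delta_space (T : topologicalType) : Prop :=
  forall D : (set T)^nat, nonincreasing_seq D -> \bigcap_n D n = set0 ->
  exists V : (set T)^nat,
    [/\ nonincreasing_seq V, \bigcap_n V n = set0,
        forall n, open (V n) & forall n, D n `<=` V n].

(* In a well-ordered set, the element [a] stands for the ordinal which is the
   order type of the initial segment of the elements below [a]. *)
Section ordinals.
Context {d : Order.disp_t} {W : orderType d}.
Implicit Types a b : W.

Definition is_omega1 a : Prop :=
  (~ countable `]-oo, a[) /\ (forall b, (b < a)%O -> countable `]-oo, b[).

(* omega_2 is the least ordinal that does not inject into omega_1. *)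
Definition is_omega2 b : Prop :=
  exists a, [/\ is_omega1 a, ~ (`]-oo, b[ #<= `]-oo, a[) &
    forall c, (c < b)%O -> `]-oo, c[ #<= `]-oo, a[].

Definition countable_cofinality a : Prop :=
  exists C : set W, [/\ C `<=` `]-oo, a[, countable C &
    forall x, (x < a)%O -> exists2 y, C y & (x <= y)%O].

End ordinals.

(* [W] is a copy of the ordinal omega_2 + 1 = [0, omega_2]. *)
Definition is_omega2_interval (d : Order.disp_t) (W : orderType d) : Prop :=
  well_order (<=%O : rel W) /\
  exists b : W, is_omega2 b /\ forall x : W, (x <= b)%O.

Lemma countable_cofinality_min (d : Order.disp_t) (W : orderType d) (a : W) :
  (forall x, (a <= x)%O) -> countable_cofinality a.
Proof.
move=> amin; exists set0; split=> //.
by move=> x; rewrite ltNge amin.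
Qed.

Lemma countable_cofinality_succ (d : Order.disp_t) (W : orderType d) (a b : W) :
  (b < a)%O -> (forall x, (x < a)%O -> (x <= b)%O) -> countable_cofinality a.
Proof.
move=> ba bmax; exists [set b]; split=> [_ ->| |x xa].
- by rewrite /= in_itv.
- exact: countable1.
- by exists b => //; exact: bmax.
Qed.

(* What follows leads to [omega2_interval_exists]: [is_omega2_interval] is
   satisfiable. *)

Section well_orders.
Context {T : choiceType} {R : rel T} (wR : well_order R).

Let wo_chainT : wo_chain R [mem T]. Proof. by move=> A _; exact: wR. Qed.

Lemma well_order_refl : reflexive R.
Proof. by move=> x; exact: (wo_chain_reflexive wo_chainT). Qed.

Lemma well_order_anti : antisymmetric R.
Proof. by move=> x y; exact: (wo_chain_antisymmetric wo_chainT). Qed.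

Lemma well_order_total : total R.
Proof. by move=> x y; exact: (wo_chainW wo_chainT). Qed.

Lemma well_order_trans : transitive R.
Proof.
move=> y x z xy yz.
have [|m [[mA mlb] _]] := wR (A := [pred t | t \in [:: x; y; z]]).
  by exists x; rewrite !inE eqxx.
have mx : R m x by apply: mlb; rewrite !inE eqxx.
have my : R m y by apply: mlb; rewrite !inE eqxx orbT.
have mz : R m z by apply: mlb; rewrite !inE eqxx !orbT.
move: mA; rewrite !inE => /or3P[] /eqP e; move: mx my mz; rewrite e.
- by [].
- by move=> yx _ _; rewrite (@well_order_anti x y) ?xy ?yx.
- by move=> _ zy _; rewrite (@well_order_anti z y) ?zy ?yz.
Qed.

Lemma well_order_least (P : T -> Prop) x : P x ->
  exists2 m, P m & forall y, P y -> R m y.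
Proof.
move=> Px; have [|m [[Pm mlb] _]] := wR (A := [pred y | `[< P y >]]).
  by exists x; exact/asboolP.
exists m => [|y Py]; first exact/asboolP.
by apply: mlb; exact/asboolP.
Qed.

Definition wo_type of well_order R : Type := T.

HB.instance Definition _ := Choice.on (wo_type wR).
HB.instance Definition _ := @Order.Le_isPOrder.Build Order.default_display
  (wo_type wR) R well_order_refl well_order_anti well_order_trans.
HB.instance Definition _ := @Order.POrder_isTotal.Build Order.default_display
  (wo_type wR) well_order_total.

Lemma wo_type_segment (a : wo_type wR) :
  `]-oo, a[%classic = [set x | (x != a) && R x a].
Proof.
by apply/seteqP; split=> x /=; rewrite in_itv /= lt_def eq_sym.
Qed.

End well_orders.

Definition sum_rel (A B : Type) (RA : rel A) (RB : rel B) : rel (A + B) :=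
  fun x y => match x, y with
  | inl a, inl a' => RA a a'
  | inl _, inr _ => true
  | inr _, inl _ => false
  | inr b, inr b' => RB b b'
  end.

Lemma sum_rel_well_order (A B : choiceType) (RA : rel A) (RB : rel B) :
  well_order RA -> well_order RB -> well_order (sum_rel RA RB).
Proof.
move=> wA wB; apply: antisymmetric_well_order.
  case=> [a|b] [a'|b'] //= => [/(well_order_anti wA)|/(well_order_anti wB)] -> //.
move=> P [z Pz]; have [[a Pa]|noA] := pselect (exists a, inl a \in P).
  have [m Pm mlb] := well_order_least wA (P := fun a => inl a \in P) Pa.
  by exists (inl m); split=> // -[a' /mlb|b].
case: z Pz => [a Pa|b Pb]; first by case: noA; exists a.
have [m Pm mlb] := well_order_least wB (P := fun b => inr b \in P) Pb.
exists (inr m); split=> // -[a' Pa'|b' /mlb //].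
by case: noA; exists a'.
Qed.

Lemma not_card_le_set (T : pointedType) : ~ ([set: set T] #<= [set: T]).
Proof.
move=> /pcard_injP[f finj].
pose D := [set x | exists2 B : set T, f B = x & ~ B x].
have [Df|nDf] := pselect (D (f D)); last by apply: (nDf); exists D.
by case: (Df) => B /finj -> //; rewrite inE.
Qed.

Definition segment (T : eqType) (R : rel T) (a : T) : set T :=
  [set x | (x != a) && R x a].

Lemma omega2_interval_of_well_order (T : choiceType) (R : rel T) (u v : T) :
    well_order R -> ~ countable (segment R u) ->
    ~ (segment R v #<= segment R u) ->
  exists W : orderType Order.default_display, is_omega2_interval W.
Proof.
move=> wR ucu nvu.
have [w1 uc1 w1min] := well_order_least wR (P := fun a => ~ countable (segment R a)) ucu.
have nv1 : ~ (segment R v #<= segment R w1).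
  move=> v1; apply: nvu; apply: card_le_trans v1 _; apply: subset_card_le.
  move=> x /andP[xw1 Rxw1]; have w1u := w1min _ ucu.
  apply/andP; split; last exact: (well_order_trans wR) Rxw1 w1u.
  apply: contraNneq xw1 => xu; apply/eqP/(well_order_anti wR).
  by rewrite Rxw1 xu.
have [w2 n2 w2min] :=
  well_order_least wR (P := fun b => ~ (segment R b #<= segment R w1)) nv1.
have w12 : R w1 w2.
  apply: w1min => c2; apply: n2; move: uc1; rewrite /countable => uc1.
  have := well_order_total wR w1 w2.
  move=> /orP[w12|w21]; last first.
    apply: subset_card_le => x /andP[xw2 Rxw2].
    apply/andP; split; last exact: (well_order_trans wR) Rxw2 w21.
    apply: contraNneq xw2 => xw1; apply/eqP/(well_order_anti wR).
    by rewrite Rxw2 xw1.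
  exfalso; apply: uc1; apply: card_le_trans c2; apply: subset_card_le.
  move=> x /andP[xw1 Rxw1].
  apply/andP; split; last exact: (well_order_trans wR) Rxw1 w12.
  apply: contraNneq xw1 => xw2; apply/eqP/(well_order_anti wR).
  by rewrite Rxw1 xw2.
pose S := {x : T | R x w2}; pose RS : rel S := fun x y => R (val x) (val y).
have wRS : well_order RS.
  apply: antisymmetric_well_order => [x y xy|P [z Pz]].
    exact/val_inj/(well_order_anti wR).
  have [|m [y [Py ->]] mlb] := well_order_least wR
      (P := fun t => exists y : S, y \in P /\ t = val y) (x := val z).
    by exists z.
  by exists y; split=> // t Pt; apply: mlb; exists t.
pose W := wo_type wRS.
have segS (a : W) : `]-oo, a[ #= segment R (val (a : S)).
  rewrite wo_type_segment.
  suff <- : val @` [set x : S | (x != a) && RS x a] = segment R (val (a : S)).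
    by apply/card_esym/inj_card_eq => x y _ _; exact: val_inj.
  apply/seteqP; split=> [_ [x /= xa <-] //|x /andP[xa Rxa]].
  exists (exist _ x (well_order_trans wR (y := val (a : S)) Rxa (valP (a : S)))) => //=.
  by rewrite /RS /= Rxa andbT -val_eqE.
exists W; split; first exact: wRS.
pose W1 : W := exist _ w1 w12.
pose W2 : W := exist _ w2 (well_order_refl wR w2).
have lt_not (P : T -> Prop) w : (forall y, ~ P y -> R w y) ->
    forall c : S, R (val c) w -> val c != w -> P (val c).
  move=> wmin c cw; apply: contra_neqP => /wmin wc.
  by apply: (well_order_anti wR); rewrite cw.
exists W2; split; last by move=> x; exact: (valP (x : S)).
exists W1; split; first split.
- by rewrite (eq_countable (segS W1)).
- move=> b; rewrite lt_def => /andP[bn bw]; rewrite (eq_countable (segS b)).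
  apply: lt_not w1min _ bw _; by rewrite eq_sym.
- by rewrite (card_le_eql (segS W2)) (card_le_eqr (segS W1)).
- move=> c; rewrite lt_def => /andP[cn cw].
  rewrite (card_le_eql (segS c)) (card_le_eqr (segS W1)).
  apply: lt_not w2min _ cw _; by rewrite eq_sym.
Qed.

Theorem omega2_interval_exists : exists (d : Order.disp_t)
  (W : orderTopologicalType d), is_omega2_interval W.
Proof.
suff [W hW] : exists W : orderType Order.default_display, is_omega2_interval W.
  by exists Order.default_display, (order_topology W).
pose A : choiceType := set nat; pose B : choiceType := set (set nat).
have Auc : ~ countable [set: A] by exact: not_card_le_set.
have BA : ~ ([set: B] #<= [set: A]) by exact: not_card_le_set.
move: A B Auc BA => A B Auc BA.
have [RA wA] := well_ordering_principle A.
have [RB wB] := well_ordering_principle B.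
have wU : well_order (fun _ _ : unit => true).
  by apply: antisymmetric_well_order => [[] []//|P [z Pz]]; exists z.
have wT := sum_rel_well_order wA (sum_rel_well_order wB wU).
have [b0 _ b0min] : exists2 b0, True & forall y, True -> RB b0 y.
  have [b _] : exists b : B, True.
    apply: contrapT => noB; apply: BA.
    suff -> : [set: B] = set0 by exact: card_ge0.
    by apply/seteqP; split=> // b _; apply: noB; exists b.
  exact: (well_order_least wB (P := fun=> True) (x := b)).
apply: (omega2_interval_of_well_order (u := inr (inl b0)) (v := inr (inr tt)) wT).
  move=> cu; apply: Auc; rewrite -(eq_countable (inj_card_eq (f := @inl A (B + unit)) _)).
    by apply: card_le_trans cu; apply: subset_card_le => _ [a _ <-].
  by move=> x y _ _ [].
move=> le; apply: BA.
rewrite -(card_le_eqr (inj_card_eq (f := @inl A (B + unit)) _)); last first.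
  by move=> x y _ _ [].
rewrite -(card_le_eql (inj_card_eq (f := @inr A (B + unit) \o @inl B unit) _)); last first.
  by move=> x y _ _ [].
apply: card_le_trans (card_le_trans le _); apply: subset_card_le.
  by move=> _ [b _ <-].
move=> [a _|[b|[]]] //=; first by exists a.
rewrite /segment /= => /andP[bn Rb0]; exfalso; move/eqP: bn; apply.
by congr (inr (inl _)); apply: (well_order_anti wB); rewrite Rb0 b0min.
Qed.

(* Main.v *)
Require Import Defs.
From mathcomp Require Import all_boot all_order interval finmap.
From mathcomp Require Import all_classical topology wochoice sequences.
From mathcomp Require Import borel_hierarchy.

Set Implicit Arguments.
Unset Strict Implicit.
Unset Printing Implicit Defensive.

Import Order.TTheory.

Local Open Scope order_scope.
Local Open Scope classical_set_scope.
Local Open Scope card_scope.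

(** The topological claims are direct.  Since [W] is well-ordered, the sets
[{x | b < x <= a}] are open in it.  A point of countable cofinality is an
intersection of countably many of them, hence isolated in the modification
([countable_cofinality_Gdelta]); at a point [a] of uncountable cofinality,
countably many left endpoints below [a] have an upper bound below [a], so the
neighbourhoods of [a] in the modification still contain a set
[{x | b < x <= a}] ([nbhs_uncountable_cofinality]).  The Lindelof property
follows by induction on [a], for the initial segments [{x | x <= a}].

The failure of the Delta property is a pressing-down argument.  Let [S] be the
set of the ordinals below [omega_2] of uncountable cofinality, which all have
cofinality [omega_1].  Suppose that [S] contains pairwise disjoint stationary
sets [E n], and put [D n := \bigcup_(m >= n) E m].  These sets decrease to the
empty set.  If [V n] is open and contains [D n], every [a] in [E n] has some
[f a < a] such that [V n] contains [{x | f a < x <= a}]; as [E n] is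
stationary, [f] is bounded by some [b n] on an unbounded part of [E n], so
[V n] contains every [x] with [b n < x < omega_2].  Since [omega_2] has
uncountable cofinality, the sets [V n] then have a common point
([modification_not_Delta]).

The sets [E n] come from an Ulam matrix ([stationary_disjoint_seq]).  This
needs Fodor's lemma for [S] ([uncountable_cofinality_stationary]) and the
closure of the nonstationary ideal under unions of [omega_1] sets
([nonstationary_bigcup]).  Both rest on the regularity of [omega_2]
([omega2_bounded]), and that on [omega_1 * omega_1 <= omega_1]
([card_omega1_setX]). *)

(** * Cardinality *)

(** The point [u] supplies the values outside [A]. *)
Lemma card_le_ex_inj (T U : Type) (A : set T) (B : set U) (u : U) :
  A #<= B <-> exists2 f : T -> U, set_fun A B f & set_inj A f.
Proof.
elim/Ppointed: U => U in u B *; first by case: (no u).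
split=> [/pcard_leP/injfunPex //|h]; exact/pcard_leP/injfunPex.
Qed.

Lemma countable_setU (T : Type) (A B : set T) :
  countable A -> countable B -> countable (A `|` B).
Proof.
move=> cA cB; rewrite -bigcup2E; apply: bigcup_countable => [//|[|[|n]] _ //=].
Qed.

Lemma countable_image (T U : Type) (f : T -> U) (A : set T) :
  countable A -> countable (f @` A).
Proof. exact/sub_countable/card_image_le. Qed.

(** * Recursion along a well-order *)

Section well_order.
Context {d : Order.disp_t} {W : orderType d}.
Hypothesis wW : well_order (<=%O : rel W).

Lemma lt_least (P : W -> Prop) x : P x ->
  exists2 m, P m & forall y, P y -> m <= y.
Proof. exact: (well_order_least wW). Qed.

Lemma transfinite_ind (P : W -> Prop) :
  (forall x, (forall y, y < x -> P y) -> P x) -> forall x, P x.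
Proof.
move=> step x; apply: contrapT => nPx.
have [m nPm mmin] := @lt_least (fun x => ~ P x) x nPx.
by apply: nPm; apply: step => y ym; apply: contrapT => /mmin; rewrite leNgt ym.
Qed.

Lemma lt_well_founded : well_founded (fun x y : W => x < y).
Proof. by apply: transfinite_ind => x IH; constructor. Qed.

(** Transfinite recursion with a choice at each step: [Q x h s] says that [s]
is an admissible value at [x] for a function whose earlier values are those of
[h].  The first hypothesis states that only the values of [h] below [x]
matter. *)
Lemma transfinite_choice (T : Type) (t0 : T) (Q : W -> (W -> T) -> T -> Prop) :
    (forall x g h t, (forall y, y < x -> g y = h y) -> Q x g t -> Q x h t) ->
    (forall x h, (forall y, y < x -> Q y h (h y)) -> exists t, Q x h t) ->
  exists h, forall x, Q x h (h x).
Proof.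
move=> Qloc Qex.
pose ext (x : W) (r : forall y : W, y < x -> T) y :=
  if pselect (y < x) is left yx then r y yx else t0.
pose F (x : W) r : T := xget (t0 : {classic T}) (Q x (ext x r)).
pose h := Fix lt_well_founded (fun=> T) F.
have hE x : h x = F x (fun y _ => h y).
  rewrite /h Fix_eq // => {}x f g fg.
  by congr F; apply: functional_extensionality_dep => y; apply/funext => p.
exists h; apply: transfinite_ind => x IH.
have e y : y < x -> ext x (fun y _ => h y) y = h y.
  by move=> yx; rewrite /ext; case: pselect.
have [t Qt] := Qex _ _ IH.
rewrite hE; apply: (Qloc _ _ _ _ e); apply: xgetPex.
by exists t; apply: Qloc Qt => y /e.
Qed.

(** * The first uncountable ordinal *)

Section omega1.
Context (o : W) (ho : is_omega1 o).

(** Regularity of [omega_1]: otherwise [omega_1] would be a countable union of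
countable initial segments. *)
Lemma omega1_bounded (C : set W) : C `<=` `]-oo, o[ -> countable C ->
  exists2 y, y < o & forall c, C c -> c < y.
Proof.
move=> Co cC; apply: contrapT => unb; case: ho => nco co; apply: nco.
suff : countable (\bigcup_(c in C) (`]-oo, c[ `|` [set c])).
  apply: sub_countable; apply: subset_card_le => y /=; rewrite in_itv /= => yo.
  apply: contrapT => ny; apply: unb; exists y => // c Cc.
  rewrite ltNge; apply/negP; rewrite le_eqVlt => /orP[/eqP yc|yc].
    by apply: ny; exists c => //; right.
  by apply: ny; exists c => //; left; rewrite /= in_itv.
apply: bigcup_countable => // c Cc; apply: countable_setU; last exact: countable1.
by apply: co; have := Co _ Cc; rewrite /= in_itv.
Qed.

(** Removing countably many points from [omega_1] leaves room for any countable
set. *)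
Lemma countable_card_le (T : Type) (A : set T) (U : set W) :
  countable A -> countable U -> A #<= `]-oo, o[ `\` U.
Proof.
move=> cA cU; apply: card_le_trans cA _; apply/infiniteP => fin.
case: ho => + _; apply.
suff : countable ((`]-oo, o[ `\` U) `|` U).
  apply: sub_countable; apply: subset_card_le => x ox.
  by have [Ux|nUx] := pselect (U x); [right|left].
by apply: countable_setU => //; exact: finite_set_countable.
Qed.

(** The fibres of [rho] are embedded into [omega_1] one after the other, each
of them away from the images of the previous ones, which together are
countable. *)
Lemma card_le_countable_fibres (T : Type) (B : set T) (rho : T -> W) :
    (forall a, B a -> rho a < o) ->
    (forall x, x < o -> countable (B `&` rho @^-1` [set x])) ->
  B #<= `]-oo, o[.
Proof.
move=> Bo cB.
pose fib x := B `&` rho @^-1` [set x].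
pose used x (h : W -> T -> W) := \bigcup_(y in `]-oo, x[) (h y @` fib y).
pose Q x h t := x < o ->
  set_fun (fib x) (`]-oo, o[ `\` used x h) t /\ set_inj (fib x) t.
have [h hQ] : exists h, forall x, Q x h (h x).
  apply: (transfinite_choice (fun=> o)) => [x g h t gh Qg xo|x h _].
    have [tf ti] := Qg xo; split=> // a /tf[ao nu]; split=> // -[y yx [b by_ e]].
    by apply: nu; exists y => //; exists b; rewrite ?gh //; move: yx; rewrite /= in_itv.
  have [xo|nxo] := pselect (x < o); last by exists (fun=> o).
  have cu : countable (used x h).
    apply: bigcup_countable => [|y]; first by case: ho => _; exact.
    rewrite /= in_itv /= => yx; apply: countable_image; apply: cB.
    exact: lt_trans xo.
  by have /(card_le_ex_inj _ _ o)[t tf ti] := countable_card_le (cB _ xo) cu; exists t.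
apply/(card_le_ex_inj _ _ o); exists (fun a => h (rho a) a) => [a Ba|a b].
  by have [/(_ a)[]] := hQ _ (Bo _ Ba).
rewrite !inE => Ba Bb; have ro := Bo _ Ba; have ro' := Bo _ Bb.
have [af ai] := hQ _ ro; have [bf bi] := hQ _ ro'.
have [lt|lt|e] := ltgtP (rho a) (rho b).
- move=> e; have [_ []] := bf b (conj Bb erefl).
  by exists (rho a); [rewrite /= in_itv|exists a].
- move=> e; have [_ []] := af a (conj Ba erefl).
  by exists (rho b); [rewrite /= in_itv|exists b].
- by rewrite -e; apply: ai; rewrite inE.
Qed.

(** There are only countably many pairs with a given maximum. *)
Lemma card_omega1_setX : `]-oo, o[ `*` `]-oo, o[ #<= `]-oo, o[.
Proof.
apply: (card_le_countable_fibres (rho := fun p => Order.max p.1 p.2)).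
  by move=> [x y] [] /=; rewrite !in_itv /= gt_max => -> ->.
move=> x xo.
suff : countable ((`]-oo, x[ `|` [set x]) `*` (`]-oo, x[ `|` [set x])).
  apply: sub_countable; apply: subset_card_le => -[y z] [_] /= yzx.
  have leU u : u <= x -> (`]-oo, x[ `|` [set x]) u.
    by rewrite le_eqVlt => /orP[/eqP ->|ux]; [right|left; rewrite /= in_itv].
  by split; apply: leU; rewrite -yzx le_max lexx ?orbT.
by apply: countableX; apply: countable_setU => //; case: ho => _ ->.
Qed.

Lemma card_le_bigcup_omega1 (I T : Type) (D : set I) (F : I -> set T) :
    D #<= `]-oo, o[ -> (forall i, D i -> F i #<= `]-oo, o[) ->
  \bigcup_(i in D) F i #<= `]-oo, o[.
Proof.
move=> /(card_le_ex_inj _ _ o)[e eD einj] leF.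
have /choice[f fF] : forall i, exists f : T -> W, D i ->
    set_fun (F i) `]-oo, o[ f /\ set_inj (F i) f.
  move=> i; have [Di|nDi] := pselect (D i); last by exists (fun=> o).
  by have /(card_le_ex_inj _ _ o)[f ff fi] := leF _ Di; exists f.
have /choice[k kD] : forall x, exists i : option I,
    (\bigcup_(i in D) F i) x -> exists2 j, i = Some j & D j /\ F j x.
  move=> x; have [[i Di Fi]|nx] := pselect ((\bigcup_(i in D) F i) x).
    by exists (Some i) => _; exists i.
  by exists None.
apply: card_le_trans card_omega1_setX; apply/(card_le_ex_inj _ _ (o, o)).
exists (fun x => if k x is Some i then (e i, f i x) else (o, o)) => [x Ux|x y].
  have [i -> [Di Fi]] := kD _ Ux; have [ff _] := fF _ Di.
  by split; [exact: eD|exact: ff].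
rewrite !inE => /kD[i -> [Di Fi]] /kD[j -> [Dj Fj]] [eij].
have {}eij : i = j by apply: einj; rewrite ?inE.
rewrite -{}eij in Dj Fj *; have [_ fi] := fF _ Di.
by apply: fi; rewrite inE.
Qed.

(** * Regularity of the second uncountable ordinal *)

Section omega2.
Context (t : W) (nt : ~ (`]-oo, t[ #<= `]-oo, o[)).
Hypothesis tmin : forall c, c < t -> `]-oo, c[ #<= `]-oo, o[.

Lemma countable_card_le_omega1 (T : Type) (A : set T) :
  countable A -> A #<= `]-oo, o[.
Proof.
by move=> cA; have := countable_card_le cA (@countable0 W); rewrite setD0.
Qed.

(** Otherwise [omega_2] would be a union of at most [omega_1] initial segments,
each of cardinality at most [omega_1]. *)
Lemma omega2_bounded (C : set W) : C `<=` `]-oo, t[ -> C #<= `]-oo, o[ ->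
  exists2 y, y < t & forall c, C c -> c < y.
Proof.
move=> Ct cC; apply: contrapT => unb; apply: nt.
suff : \bigcup_(c in C) (`]-oo, c[ `|` [set c]) #<= `]-oo, o[.
  apply: card_le_trans; apply: subset_card_le => y /=; rewrite in_itv /= => yt.
  apply: contrapT => ny; apply: unb; exists y => // c Cc.
  rewrite ltNge; apply/negP; rewrite le_eqVlt => /orP[/eqP yc|yc].
    by apply: ny; exists c => //; right.
  by apply: ny; exists c => //; left; rewrite /= in_itv.
apply: card_le_bigcup_omega1 => // c Cc; rewrite -bigcup2E.
apply: card_le_bigcup_omega1 => [|[|[|n]] _ /=].
- exact: countable_card_le_omega1.
- by apply: tmin; have := Ct _ Cc; rewrite /= in_itv.
- exact: countable_card_le_omega1 (countable1 c).
- exact: card_ge0.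
Qed.

(** * Stationary sets *)

(** Fodor's lemma turned into a definition.  For subsets of [omega_2] that do
not contain [0] it agrees with the usual notion, disjointness from some closed
unbounded set; it makes the closure of the ideal under unions immediate. *)
Definition nonstationary (A : set W) := exists f : W -> W,
  (forall a, A a -> f a < a) /\
  forall b, b < t -> exists2 y, y < t & forall a, A a -> f a <= b -> a <= y.

(** Any choice, for each point [a] of the union, of an index [i] with [a] in
[A i] glues the witnesses [f i] together: the points that the glued function
sends to [b] or below are bounded by the supremum of at most [omega_1] bounds. *)
Lemma nonstationary_bigcup (I : Type) (D : set I) (A : I -> set W) :
    D #<= `]-oo, o[ -> (forall i, D i -> nonstationary (A i)) ->
  nonstationary (\bigcup_(i in D) A i).
Proof.
move=> cD nsA.
have /choice[f fA] : forall i, exists f : W -> W, D i ->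
    (forall a, A i a -> f a < a) /\
    forall b, b < t -> exists2 y, y < t & forall a, A i a -> f a <= b -> a <= y.
  move=> i; have [Di|nDi] := pselect (D i); last by exists id.
  by have [f ?] := nsA _ Di; exists f.
have /choice[g gA] : forall a, exists s, (\bigcup_(i in D) A i) a ->
    exists i, [/\ D i, A i a & s = f i a].
  move=> a; have [[i Di Ai]|nx] := pselect ((\bigcup_(i in D) A i) a).
    by exists (f i a) => _; exists i.
  by exists a.
exists g; split=> [a /gA[i [Di Aia ->]]|b bt].
  by have [] := fA _ Di => /(_ _ Aia).
have /choice[y yA] : forall i, exists y, D i ->
    y < t /\ forall a, A i a -> f i a <= b -> a <= y.
  move=> i; have [Di|nDi] := pselect (D i); last by exists b.
  by have [_ /(_ _ bt)[y]] := fA _ Di; exists y.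
have [||z zt zy] := @omega2_bounded (y @` D).
- by move=> _ [i /yA[yt _] <-]; rewrite /= in_itv.
- exact: card_le_trans (card_image_le _ _) cD.
exists z => // a /gA[i [Di Aia ->]] fab.
have [_ /(_ _ Aia fab) ay] := yA _ Di.
by apply: le_trans ay (ltW _); apply: zy; exists i.
Qed.

Lemma subset_nonstationary (A B : set W) :
  A `<=` B -> nonstationary B -> nonstationary A.
Proof.
move=> AB [f [fr fb]]; exists f; split=> [a /AB/fr //|b /fb[y yt yB]].
by exists y => // a /AB; exact: yB.
Qed.

(** Fodor's lemma for the points of uncountable cofinality.  If [f] were a
witness of nonstationarity, with [g b] a bound of the points [a] such that
[f a <= b], iterating [g] along [omega_1] would give a [c] of cofinality
[omega_1] with cofinally many [z < c] such that [g z < c].  As [f c < c], one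
of them satisfies [f c <= z], whence [c <= g z < c]. *)
Lemma uncountable_cofinality_stationary b : b < t ->
  ~ nonstationary [set a | [/\ b < a, a < t & ~ countable_cofinality a]].
Proof.
set S := [set a | _] => bt [f [freg fbnd]].
have /choice[g gP] : forall c, exists y, c < t ->
    y < t /\ forall a, S a -> f a <= c -> a <= y.
  move=> c; have [ct|nct] := pselect (c < t); last by exists c.
  by have [y yt yS] := fbnd _ ct; exists y.
(* Starting above [b] puts the supremum of [h] into [S]. *)
pose Q x (h : W -> W) s := x < o ->
  [/\ s < t, b < s & forall z, z < x -> h z < s /\ g (h z) < s].
have [h hQ] : exists h, forall x, Q x h (h x).
  apply: (transfinite_choice b) => [x h k s hk Qh xo|x h IH].
    by have [st bs sh] := Qh xo; split=> // z zx; rewrite -hk//; exact: sh.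
  have [xo|nxo] := pselect (x < o); last by exists b.
  have ht z : z < x -> h z < t by move=> zx; have [] := IH _ zx (lt_trans zx xo).
  pose C := [set b] `|` (h @` `]-oo, x[ `|` (g \o h) @` `]-oo, x[).
  have cx : countable `]-oo, x[ by case: ho => _; exact.
  have [||s st sC] := @omega2_bounded C.
  - move=> _ [->|[[z zx <-]|[z zx <-]]]; rewrite /= in_itv //=; last first.
      by case: (gP (h z)) => //; apply: ht; move: zx; rewrite /= in_itv.
    by apply: ht; move: zx; rewrite /= in_itv.
  - apply: countable_card_le_omega1; apply: countable_setU (countable1 _) _.
    by apply: countable_setU; exact: countable_image.
  exists s => _; split=> //; first by apply: sC; left.
  move=> z zx; split; apply: sC; right; [left|right]; exists z => //=;
    by rewrite in_itv.
have ht z : z < o -> h z < t by move=> /hQ[].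
have hlt z x : z < x -> x < o -> h z < h x.
  by move=> zx /hQ[_ _ /(_ _ zx)[]].
have ghlt z x : z < x -> x < o -> g (h z) < h x.
  by move=> zx /hQ[_ _ /(_ _ zx)[]].
have [||u ut hu] := @omega2_bounded (h @` `]-oo, o[).
- by move=> _ [z zo <-]; rewrite /= in_itv; apply: ht; move: zo; rewrite /= in_itv.
- exact: card_image_le.
have {}hu z : z < o -> h z <= u.
  by move=> zo; apply/ltW/hu; exists z; rewrite //= in_itv.
(* The supremum [c] is the least upper bound, and not just any bound, so that
   the values of [h] are cofinal in it. *)
have [c hc cmin] := @lt_least (fun u => forall z, z < o -> h z <= u) u hu.
have ct : c < t by exact: le_lt_trans (cmin _ hu) ut.
have onext z : z < o -> exists2 x, x < o & z < x.
  move=> zo; have [||x xo /(_ z erefl)] := @omega1_bounded [set z].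
  - by move=> _ ->; rewrite /= in_itv.
  - exact: countable1.
  - by exists x.
have hltc z : z < o -> h z < c.
  by move=> zo; have [x xo zx] := onext z zo; exact: lt_le_trans (hlt _ _ zx xo) (hc _ xo).
have below_h x : x < c -> exists2 z, z < o & x < h z.
  move=> xc; apply: contrapT => nz; move: xc; rewrite ltNge => /negP; apply.
  apply: cmin => z zo; rewrite leNgt; apply/negP => xh.
  by apply: nz; exists z.
have [z0 z0o] : exists z, z < o.
  have [||y yo _] := @omega1_bounded set0 => //; by exists y.
have bc : b < c by have [_ bh _] := hQ _ z0o; exact: lt_trans bh (hltc _ z0o).
have Sc : S c.
  split=> // -[C [Cc cC Ccof]].
  have /choice[k kP] : forall x, exists z, x < c -> z < o /\ x < h z.
    move=> x; have [/below_h[z zo xh]|nxc] := pselect (x < c); first by exists z.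
    by exists x.
  have Clt x : C x -> x < c by move=> /Cc; rewrite /= in_itv.
  have [||y yo yk] := @omega1_bounded (k @` C).
  - by move=> _ [x /Clt/kP[ko _] <-]; rewrite /= in_itv.
  - exact: countable_image.
  have [x Cx] := Ccof _ (hltc _ yo); rewrite leNgt => /negP; apply.
  have [ko xh] := kP _ (Clt _ Cx); apply: lt_trans xh _.
  by apply: hlt => //; apply: yk; exists x.
have [z zo fz] := below_h _ (freg _ Sc).
have [x xo zx] := onext _ zo.
have [_ /(_ c Sc (ltW fz)) cg] := gP _ (ht _ zo).
by have := lt_trans (le_lt_trans cg (ghlt _ _ zx xo)) (hltc _ xo); rewrite ltxx.
Qed.

(** Ulam matrix.  Let [i a] be an injection of [a] into [omega_1], and [A b x]
the set of the points [a] of uncountable cofinality in the interval between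
[b] and [omega_2] such that [i a b = x].  For fixed [b] the sets [A b x] cover
a stationary set, so [A b (k b)] is stationary for some [k b].  For fixed [x]
the sets [A b x] are pairwise disjoint, and by cardinality [k] takes some value
[x] infinitely often. *)
Lemma stationary_disjoint_seq : exists E : nat -> set W,
  [/\ forall n, E n `<=` [set a | a < t /\ ~ countable_cofinality a],
      forall n, ~ nonstationary (E n) &
      forall m n a, E m a -> E n a -> m = n].
Proof.
have /choice[i iP] : forall a, exists f : W -> W, a < t ->
    set_fun `]-oo, a[ `]-oo, o[ f /\ set_inj `]-oo, a[ f.
  move=> a; have [/tmin/(card_le_ex_inj _ _ o)[f ff fi]|nat] := pselect (a < t).
    by exists f.
  by exists id.
pose A b x := [set a | [/\ b < a, a < t, ~ countable_cofinality a & i a b = x]].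
have /choice[k kP] : forall b, exists x, b < t -> x < o /\ ~ nonstationary (A b x).
  move=> b; have [bt|nbt] := pselect (b < t); last by exists b.
  apply: contrapT => nx; apply: (uncountable_cofinality_stationary bt).
  apply: (@subset_nonstationary _ (\bigcup_(x in `]-oo, o[) A b x)).
    move=> a [ba at_ nca]; exists (i a b) => //.
    by have [fi _] := iP _ at_; apply: fi; rewrite /= in_itv.
  apply: nonstationary_bigcup => // x; rewrite /= in_itv /= => xo.
  by apply: contrapT => nns; apply: nx; exists x.
have [x xo infx] : exists2 x, x < o & infinite_set [set b | b < t /\ k b = x].
  apply: contrapT => fin; apply: nt.
  suff : \bigcup_(x in `]-oo, o[) [set b | b < t /\ k b = x] #<= `]-oo, o[.
    apply: card_le_trans; apply: subset_card_le => b; rewrite /= in_itv /= => bt.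
    by exists (k b) => //; rewrite /= in_itv; have [] := kP _ bt.
  apply: card_le_bigcup_omega1 => // x; rewrite /= in_itv /= => xo.
  apply: countable_card_le_omega1; apply: finite_set_countable.
  by apply: contrapT => ?; apply: fin; exists x.
have /infiniteP/(card_le_ex_inj _ _ o)[b bx binj] := infx.
have {}bx n : b n < t /\ k (b n) = x by exact: bx.
exists (fun n => A (b n) x); split=> [n a [] //|n|m n a].
  by have [bt <-] := bx n; have [] := kP _ bt.
move=> [ma at_ _ iam] [na _ _ ian]; apply: binj; rewrite ?inE //.
have [_ iinj] := iP _ at_.
by apply: iinj; rewrite ?inE /= ?in_itv // iam.
Qed.

End omega2.
End omega1.
End well_order.

(** * The modification of an arbitrary space *)

Section Gdelta_modification_theory.
Context {T : topologicalType}.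
Local Notation Td := (Gdelta_modification T).

Lemma Gdelta_bigcap (F : (set T)^nat) :
  (forall i, Gdelta (F i)) -> Gdelta (\bigcap_i F i).
Proof.
move=> dF.
have /choice[G GF] : forall i, exists G : (set T)^nat,
    (forall j, open (G j)) /\ F i = \bigcap_j G j.
  by move=> i; have [G] := dF i; exists G.
have /pcard_eqP/bijPex[e [_ _ esurj]] : [set: nat] #= [set: nat * nat].
  by rewrite card_eq_sym card_nat2.
exists (fun n => G (e n).1 (e n).2) => [i|]; first by have [] := GF (e i).1.
apply/seteqP; split=> [x Fx n _|x Gx i _].
  by have := Fx (e n).1 Logic.I; have [_ ->] := GF (e n).1; apply.
have [_ ->] := GF i; move=> j _; have [n _ en] := esurj (i, j) Logic.I.
by have := Gx n Logic.I; rewrite en.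
Qed.

Lemma Gdelta_open_modification (G : set T) : Gdelta G -> @open Td G.
Proof.
move=> dG; exists [set G]; last by rewrite bigcup_set1.
move=> _ ->; exists [fset G]%fset; last by rewrite set_fset1 bigcap_set1.
by move=> H /fset1P ->; exact: mem_set.
Qed.

(** The subbase defining the modification is a base, as finite intersections of
G-delta sets are G-delta; they are written below as countable ones, padded with
the whole space. *)
Lemma nbhs_modification (x : T) (U : set T) :
  @nbhs _ Td x U -> exists G : set T, [/\ Gdelta G, G x & G `<=` U].
Proof.
rewrite nbhsE => -[V [[D sD <-]] [H DH Hx] VU].
have [F FG HF] := sD _ DH; exists H; split=> //; last first.
  by move=> y Hy; apply: VU; exists H.
rewrite -HF.
have -> : \bigcap_(i in [set` F]) i =
    \bigcap_n (if (n < size F)%N then nth setT F n else setT).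
  apply/seteqP; split=> [y Fy n _|y Fy A /= AF].
    by case: ifP => // nF; apply: Fy; exact: mem_nth.
  have := Fy (index A F) Logic.I.
  by rewrite index_mem AF nth_index.
apply: Gdelta_bigcap => n; case: ifP => nF; last exact/open_Gdelta/openT.
by apply/set_mem/FG; exact: mem_nth.
Qed.

Lemma Gdelta_modification_P_space : P_space Td.
Proof.
move=> F oF; rewrite openE => x Fx.
have /choice[G GF] : forall i, exists G : set T, [/\ Gdelta G, G x & G `<=` F i].
  move=> i; apply: nbhs_modification; apply: open_nbhs_nbhs; split=> //.
  exact: Fx.
rewrite /interior nbhsE /=; exists (\bigcap_i G i); last first.
  by move=> y Gy i _; have [_ _] := GF i; apply; exact: Gy.
split; last by move=> i _; case: (GF i).
by apply/Gdelta_open_modification/Gdelta_bigcap => i; case: (GF i).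
Qed.

End Gdelta_modification_theory.

(** * The order topology of a well-order *)

Section well_ordered_topology.
Context {d : Order.disp_t} {W : orderTopologicalType d}.
Hypothesis wW : well_order (<=%O : rel W).
Local Notation X := (Gdelta_modification W).

(** The set is the open ray below the successor of [a], or the whole space. *)
Lemma open_le (a : W) : open [set x | x <= a].
Proof.
have [[b ab]|amax] := pselect (exists b, a < b).
  have [c ac cmin] := @lt_least _ _ wW (fun c => a < c) b ab.
  rewrite (_ : [set x | _] = `]-oo, c[%classic); first exact: lray_open.
  apply/seteqP; split=> x /=; rewrite in_itv /= => xa.
    exact: le_lt_trans ac.
  by rewrite leNgt; apply/negP => /cmin; rewrite leNgt xa.
rewrite (_ : [set x | _] = setT); first exact: openT.
by apply/seteqP; split=> // x _ /=; rewrite leNgt; apply/negP => ax; apply: amax; exists x.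
Qed.

Lemma open_ltle (b a : W) : open [set x | b < x <= a].
Proof.
rewrite (_ : [set x | _] = `]b, +oo[%classic `&` [set x | x <= a]).
  by apply: openI; [exact: rray_open|exact: open_le].
by apply/seteqP; split=> x /=; rewrite in_itv /= andbT => /andP.
Qed.

Lemma nbhs_ltle (a x : W) (U : set W) : nbhs a U -> x < a ->
  exists2 b, b < a & forall y, b < y -> y <= a -> U y.
Proof.
rewrite itv_nbhsE => -[[p q] [/= oi ai] iU] xa.
case: p oi ai iU => [[] b|[]] oi ai iU.
- by move/itv_open_ends_lside: oi.
- move: ai; rewrite itv_boundlr => /andP[/= ba aq].
  exists b => [//|y by_ ya]; apply: iU; rewrite /= itv_boundlr.
  by apply/andP; split=> //; apply: le_trans aq; rewrite bnd_simp.
- exists x => // y xy ya; apply: iU; move: ai; rewrite /= !itv_boundlr => /andP[_ aq].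
  by apply/andP; split=> //; apply: le_trans aq; rewrite bnd_simp.
- by move: ai; rewrite itv_boundlr.
Qed.

(** The least element of a nonempty set is isolated in it. *)
Lemma well_ordered_scattered : scattered W.
Proof.
move=> A [x Ax]; have [m Am mmin] := lt_least wW Ax.
exists m; split; first exact: mem_set.
exists [set x | x <= m].
  by apply: open_nbhs_nbhs; split; [exact: open_le|rewrite /= lexx].
apply/seteqP; split=> [y [/= ym Ay]|_ ->]; last by rewrite /= lexx.
by apply/le_anti; rewrite ym mmin.
Qed.

(** The least [a] such that every set of the filter meets [{x | x <= a}] is a
cluster point: for [b < a] some set of the filter lies above [b], so all
sets of the filter meet [{x | b < x <= a}]. *)
Lemma well_ordered_compact (t : W) : (forall x, x <= t) -> compact [set: W].
Proof.
move=> tmax F FF _.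
pose P a := forall A, F A -> exists2 x, A x & x <= a.
have Pt : P t by move=> A /filter_ex[x Ax]; exists x.
have [a Pa amin] := lt_least wW Pt.
exists a; split=> // A U FA aU.
have [[x xa]|nx] := pselect (exists x, x < a); last first.
  have [x Ax xa] := Pa _ FA; exists x; split=> //.
  suff -> : x = a by exact: nbhs_singleton.
  by apply/le_anti; rewrite xa leNgt; apply/negP => ?; apply: nx; exists x.
have [b ba bU] := nbhs_ltle aU xa.
have [B FB Bb] : exists2 B, F B & forall x, B x -> b < x.
  apply: contrapT => nB; have : P b.
    move=> B FB; apply: contrapT => nx; apply: nB; exists B => // y By.
    by rewrite ltNge; apply/negP => yb; apply: nx; exists y.
  by move=> /amin; rewrite leNgt ba.
have [y [Ay By] ya] := Pa _ (filterI FA FB).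
by exists y; split=> //; apply: bU => //; exact: Bb.
Qed.

Lemma countable_cofinality_Gdelta (a : W) :
  countable_cofinality a -> Gdelta [set a].
Proof.
move=> [C [Ca cC Ccof]].
have /pfcard_geP[C0|[c]] := cC.
  rewrite (_ : [set a] = [set x | x <= a]); first exact/open_Gdelta/open_le.
  apply/seteqP; split=> [_ -> /=|x /= xa]; first by rewrite lexx.
  apply/le_anti; rewrite xa leNgt; apply/negP => /Ccof[y].
  by rewrite C0.
exists (fun n => [set x | c n < x <= a]); first by move=> n; exact: open_ltle.
apply/seteqP; split=> [_ -> n _ /=|x cx].
  rewrite lexx andbT; have /Ca : C (c n) by exact: funS.
  by rewrite /= in_itv.
have /andP[_ xa] := cx 0%N Logic.I; apply/le_anti; rewrite xa leNgt.
apply/negP => /Ccof[_ /(@surj _ _ _ _ c)[n _ <-]].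
by have /andP[cnx _] := cx n Logic.I; rewrite leNgt cnx.
Qed.

Lemma isolated_countable_cofinality (a : W) :
  countable_cofinality a -> isolated [set: X] (a : X).
Proof.
move=> /countable_cofinality_Gdelta/Gdelta_open_modification oa.
split; first exact: mem_set.
by exists [set a]; [exact: open_nbhs_nbhs|rewrite setIT].
Qed.

(** The endpoints given by the countably many open sets of which a G-delta
neighbourhood is the intersection are not cofinal in [a]. *)
Lemma nbhs_uncountable_cofinality (a : W) (U : set W) :
    ~ countable_cofinality a -> @nbhs _ X a U ->
  exists2 b, b < a & forall x, b < x -> x <= a -> U x.
Proof.
move=> nca /nbhs_modification[G [[F oF GF] Ga GU]].
have [x0 x0a] : exists x, x < a.
  apply: contrapT => nx; apply: nca; exists set0; split=> // x xa.
  by exfalso; apply: nx; exists x.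
have /choice[b bP] : forall n, exists b, b < a /\ forall x, b < x -> x <= a -> F n x.
  move=> n; have [|b ba bF] := @nbhs_ltle a x0 (F n) _ x0a; last by exists b.
  apply: open_nbhs_nbhs; split=> //.
  by have : G a by []; rewrite GF; exact.
apply: contrapT => nb; apply: nca; exists (range b); split.
- by move=> _ [n _ <-]; rewrite /= in_itv; case: (bP n).
- exact/countable_image.
- move=> x xa; apply: contrapT => nx; apply: nb; exists x => // y xy ya.
  apply: GU; rewrite GF => n _; have [_] := bP n; apply=> //.
  apply: le_lt_trans xy; rewrite leNgt; apply/negP => xb.
  by apply: nx; exists (b n); [exists n|exact: ltW].
Qed.

Lemma limit_point_uncountable_cofinality (a : W) :
  ~ countable_cofinality a -> limit_point [set: X] (a : X).
Proof.
move=> nca U aU; have [b ba bU] := nbhs_uncountable_cofinality nca aU.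
have [x bx xa] : exists2 x, b < x & x < a.
  apply: contrapT => nx; apply: nca; exists [set b]; split.
  - by move=> _ ->; rewrite /= in_itv.
  - exact: countable1.
  - move=> x xa; exists b => //; rewrite leNgt; apply/negP => bx.
    by apply: nx; exists x.
by exists x; split=> //; [rewrite lt_eqF|apply: bU => //; exact: ltW].
Qed.

(** By induction on [a], countably many sets of the cover suffice for
[{x | x <= a}]: one set of the cover contains [a], and what it misses below [a]
lies in countably many shorter segments, those below a countable cofinal set,
or a single one if the cofinality of [a] is uncountable. *)
Lemma modification_lindelof (t : W) : (forall x, x <= t) -> lindelof X.
Proof.
move=> tmax U oU covU.
suff cov : forall a : W, exists V, [/\ V `<=` U, countable V &
    forall x, x <= a -> (\bigcup_(A in V) A) x].
  have [V [VU cV covV]] := cov t.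
  by exists V; split=> //; apply/seteqP; split=> // x _; exact: covV.
apply: (transfinite_ind wW) => a IH.
have /choice[V VP] : forall b, exists V, b < a -> [/\ V `<=` U, countable V &
    forall x, x <= b -> (\bigcup_(A in V) A) x].
  move=> b; have [/IH[V ?]|nba] := pselect (b < a); first by exists V.
  by exists set0.
have [A UA Aa] : exists2 A, U A & A a.
  by have : (\bigcup_(A in U) A) (a : X) by rewrite covU.
have [C [Ca cC Ccov]] : exists C, [/\ forall c : W, C c -> c < a, countable C &
    forall x, x < a -> A x \/ exists2 c, C c & x <= c].
  have [[C [Ca cC Ccof]]|nca] := pselect (countable_cofinality a).
    exists C; split=> [c /Ca|//|x /Ccof]; first by rewrite /= in_itv.
    by right.
  have [|b ba bA] := @nbhs_uncountable_cofinality a A nca.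
    by apply: open_nbhs_nbhs; split=> //; exact: oU.
  exists [set b]; split=> [_ -> //||x xa]; first exact: countable1.
  have [xb|bx] := leP x b; first by right; exists b.
  by left; apply: bA => //; exact: ltW.
exists ([set A] `|` \bigcup_(c in C) V c); split.
- by move=> B [->//|[c /Ca/VP[VU _ _] /VU]].
- apply: countable_setU; first exact: countable1.
  by apply: bigcup_countable => // c /Ca/VP[].
- move=> x; rewrite le_eqVlt => /orP[/eqP ->|/Ccov[Ax|[c Cc xc]]].
  + by exists A => //; left.
  + by exists A => //; left.
  + have [_ _ /(_ _ xc)[B VB Bx]] := VP _ (Ca _ Cc).
    by exists B => //; right; exists c.
Qed.

Lemma modification_not_Delta (o t : W) : is_omega1 o ->
    ~ (`]-oo, t[ #<= `]-oo, o[) ->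
    (forall c, c < t -> `]-oo, c[ #<= `]-oo, o[) ->
  ~ Delta_space X.
Proof.
move=> ho nt tmin Delta.
have [E [Et nsE trivE]] := stationary_disjoint_seq wW ho nt tmin.
pose D n : set X := \bigcup_(m in [set m | (n <= m)%N]) E m.
have [||V [_ V0 oV DV]] := Delta D.
- apply/nonincreasing_seqP => n; apply/subsetPset => a [m /= nm Ema].
  by exists m => //=; exact: ltnW.
- apply/seteqP; split=> // a Da.
  have [m _ Ema] := Da 0%N Logic.I; have [k /= mk Eka] := Da m.+1 Logic.I.
  by move: mk; rewrite (trivE _ _ _ Ema Eka) ltnn.
have /choice[b bV] : forall n, exists b, b < t /\
    forall x, b < x -> x < t -> V n x.
  move=> n.
  have /choice[f fP] : forall a, exists c, E n a ->
      c < a /\ forall x, c < x -> x <= a -> V n x.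
    move=> a; have [Ena|nE] := pselect (E n a); last by exists a.
    have [_ nca] := Et _ _ Ena.
    have [|c ca cV] := @nbhs_uncountable_cofinality a (V n) nca; last by exists c.
    by apply: open_nbhs_nbhs; split; [exact: oV|apply: DV; exists n => //=].
  apply: contrapT => nb; apply: (nsE n); exists f; split=> [a /fP[]//|b bt].
  apply: contrapT => ny; apply: nb; exists b; split=> // x bx xt.
  have [a [Ena fa xa]] : exists a, [/\ E n a, f a <= b & x < a].
    apply: contrapT => na; apply: ny; exists x => // a Ena fa.
    by rewrite leNgt; apply/negP => xa; apply: na; exists a.
  have [_] := fP _ Ena; apply; [exact: le_lt_trans bx|exact: ltW].
have [||y yt by_] := @omega2_bounded _ _ wW _ ho _ nt tmin (range b).
- by move=> _ [n _ <-]; rewrite /= in_itv; case: (bV n).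
- by apply: countable_card_le_omega1 => //; exact: countable_image.
suff : (\bigcap_n V n) y by rewrite V0.
by move=> n _; have [_] := bV n; apply=> //; apply: by_; exists n.
Qed.

End well_ordered_topology.

Theorem mainTheorem6 (d : Order.disp_t) (W : orderTopologicalType d)
    (hW : is_omega2_interval W) :
  (compact [set: W] /\ scattered W) /\
  let X : topologicalType := Gdelta_modification W in
  [/\ lindelof X,
      P_space X,
      forall a : W, countable_cofinality a -> isolated [set: X] a,
      forall a : W, ~ countable_cofinality a -> limit_point [set: X] a
    & ~ Delta_space X].
Proof.
have [wW [t [[o [ho nt tmin]] tmax]]] := hW.
split; first by split; [exact: well_ordered_compact tmax|exact: well_ordered_scattered].
split.
- exact: modification_lindelof tmax.
- exact: Gdelta_modification_P_space.
- exact: isolated_countable_cofinality.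
- exact: limit_point_uncountable_cofinality.
- exact: modification_not_Delta ho nt tmin.
Qed.
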